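(* Let $\mathcal{Q}$ be a small quantaloid and let $\phi:\mathbb{A}\rightsquigarrow\mathbb{B}$ be a $\mathcal{Q}$-distributor between $\mathcal{Q}$-categories. Define $\mathcal{Q}$-functors $\phi^*:\mathcal{P}\mathbb{B}\to\mathcal{P}\mathbb{A}$, $\phi^*(\lambda)=\lambda\circ\phi$; $\phi_*:\mathcal{P}\mathbb{A}\to\mathcal{P}\mathbb{B}$, $\phi_*(\mu)=\mu\swarrow\phi$; $\phi^{\dagger}:\mathcal{P}^{\dagger}\mathbb{A}\to\mathcal{P}^{\dagger}\mathbb{B}$, $\phi^{\dagger}(\mu)=\phi\circ\mu$; and $\phi_{\dagger}:\mathcal{P}^{\dagger}\mathbb{B}\to\mathcal{P}^{\dagger}\mathbb{A}$, $\phi_{\dagger}(\lambda)=\phi\searrow\lambda$. Then $\phi^*\dashv\phi_*$ (with $\phi^*:\mathcal{P}\mathbb{B}\to\mathcal{P}\mathbb{A}$ the left adjoint) and $\phi_{\dagger}\dashv\phi^{\dagger}$ (with $\phi_{\dagger}:\mathcal{P}^{\dagger}\mathbb{B}\to\mathcal{P}^{\dagger}\mathbb{A}$ the left adjoint) in $\mathcal{Q}\text{-}\mathbf{Cat}$.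
   Context: A quantaloid $\mathcal{Q}$ is a category whose hom-sets are complete lattices and whose composition preserves arbitrary joins in each variable; it is small if its objects $\mathcal{Q}_0$ and arrows form sets. For $f:X\to Y$, $g:Y\to Z$, $h:X\to Z$ in a quantaloid, $h\swarrow f:Y\to Z$ is the largest arrow with $(h\swarrow f)\circ f\le h$, and $g\searrow h:X\to Y$ is the largest arrow with $g\circ(g\searrow h)\le h$. A $\mathcal{Q}$-category $\mathbb{A}$ is a set $\mathbb{A}_0$ with a type map $t:\mathbb{A}_0\to\mathcal{Q}_0$ and hom-arrows $\mathbb{A}(x,y)\in\mathcal{Q}(tx,ty)$ with $1_{tx}\le\mathbb{A}(x,x)$ and $\mathbb{A}(y,z)\circ\mathbb{A}(x,y)\le\mathbb{A}(x,z)$. A $\mathcal{Q}$-functor $F:\mathbb{A}\to\mathbb{B}$ is a type-preserving map with $\mathbb{A}(x,x')\le\mathbb{B}(Fx,Fx')$. The underlying preorder on $\mathbb{A}_0$ is: $x\le y$ iff $tx=ty$ and $1_{tx}\le\mathbb{A}(x,y)$; $\mathcal{Q}$-functors are ordered pointwise. $\mathcal{Q}$-categories and $\mathcal{Q}$-functors form $\mathcal{Q}\text{-}\mathbf{Cat}$. An adjunction $F\dashv G$ of $\mathcal{Q}$-functors $F:\mathbb{A}\to\mathbb{B}$, $G:\mathbb{B}\to\mathbb{A}$ means $1_{\mathbb{A}}\le G\circ F$ and $F\circ G\le 1_{\mathbb{B}}$. A $\mathcal{Q}$-distributor $\phi:\mathbb{A}\rightsquigarrow\mathbb{B}$ assigns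 to each $(x,y)\in\mathbb{A}_0\times\mathbb{B}_0$ an arrow $\phi(x,y)\in\mathcal{Q}(tx,ty)$ with $\mathbb{B}(y',y)\circ\phi(x,y')\le\phi(x,y)$ and $\phi(x',y)\circ\mathbb{A}(x,x')\le\phi(x,y)$. $\mathcal{Q}$-categories and $\mathcal{Q}$-distributors form a quantaloid $\mathcal{Q}\text{-}\mathbf{Dist}$ with pointwise order, composition $(\psi\circ\phi)(x,z)=\bigvee_y\psi(y,z)\circ\phi(x,y)$, identities given by hom-arrows, and implications $(\eta\swarrow\phi)(y,z)=\bigwedge_x\eta(x,z)\swarrow\phi(x,y)$, $(\psi\searrow\eta)(x,y)=\bigwedge_z\psi(y,z)\searrow\eta(x,z)$. For $X\in\mathcal{Q}_0$, $*_X$ is the $\mathcal{Q}$-category with one object of type $X$ and hom-arrow $1_X$. $\mathcal{P}\mathbb{A}$ has as objects of type $X$ the distributors $\mu:\mathbb{A}\rightsquigarrow *_X$, with $\mathcal{P}\mathbb{A}(\mu,\lambda)=\lambda\swarrow\mu$. $\mathcal{P}^{\dagger}\mathbb{A}$ has as objects of type $X$ the distributors $\mu:*_X\rightsquigarrow\mathbb{A}$, with $\mathcal{P}^{\dagger}\mathbb{A}(\mu,\lambda)=\lambda\searrow\mu$; thus the underlying order of $\mathcal{P}^{\dagger}\mathbb{A}$ is the reverse of the order of distributors. *)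

(* Defs.v *)
(* Plain Rocq with ssreflect tactics from MathComp.  MathComp's ordered types
   carry a choice structure and have no arbitrary joins, so complete lattices
   are introduced here as bare records. *)
From mathcomp Require Import ssreflect ssrfun ssrbool.
Set Implicit Arguments. Unset Strict Implicit. Unset Printing Implicit Defensive.

Declare Scope quantaloid_scope.
Delimit Scope quantaloid_scope with qtl.
Local Open Scope quantaloid_scope.

Record completeLattice := CompleteLattice {
  lat_car :> Type;
  le : lat_car -> lat_car -> Prop;
  le_refl : forall x, le x x;
  le_trans : forall y x z, le x y -> le y z -> le x z;
  le_antisym : forall x y, le x y -> le y x -> x = y;
  join : (lat_car -> Prop) -> lat_car;
  join_ub : forall (S : lat_car -> Prop) x, S x -> le x (join S);
  join_least : forall (S : lat_car -> Prop) u,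
    (forall x, S x -> le x u) -> le (join S) u }.

Notation "x ≤ y" := (le x y) (at level 70, no associativity) : quantaloid_scope.

Definition meet (L : completeLattice) (S : L -> Prop) : L :=
  join (fun l => forall x, S x -> l ≤ x).

Definition fjoin (L : completeLattice) (I : Type) (F : I -> L) : L :=
  join (fun x => exists i, x = F i).

Definition fmeet (L : completeLattice) (I : Type) (F : I -> L) : L :=
  meet (fun x => exists i, x = F i).

Record quantaloid := Quantaloid {
  ob :> Type;
  hom : ob -> ob -> completeLattice;
  idq : forall X, hom X X;
  compq : forall X Y Z, hom Y Z -> hom X Y -> hom X Z;
  compq1 : forall X Y (f : hom X Y), compq f (idq X) = f;
  comp1q : forall X Y (f : hom X Y), compq (idq Y) f = f;
  compqA : forall X Y Z W (h : hom Z W) (g : hom Y Z) (f : hom X Y),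
    compq h (compq g f) = compq (compq h g) f;
  compq_joinr : forall X Y Z (g : hom Y Z) (S : hom X Y -> Prop),
    compq g (join S) = join (fun h => exists2 f, S f & h = compq g f);
  compq_joinl : forall X Y Z (S : hom Y Z -> Prop) (f : hom X Y),
    compq (join S) f = join (fun h => exists2 g, S g & h = compq g f) }.

Arguments idq {q} X.
Notation "g ∘ f" := (compq g f) (at level 40, left associativity)
  : quantaloid_scope.

Definition lda (Q : quantaloid) (X Y Z : Q) (h : hom X Z) (f : hom X Y)
  : hom Y Z := join (fun g => g ∘ f ≤ h).

Definition rda (Q : quantaloid) (X Y Z : Q) (g : hom Y Z) (h : hom X Z)
  : hom X Y := join (fun f => g ∘ f ≤ h).

Notation "h ↙ f" := (lda h f) (at level 45, no associativity)
  : quantaloid_scope.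
Notation "g ↘ h" := (rda g h) (at level 45, no associativity)
  : quantaloid_scope.

Section Lattice.
Variables (L : completeLattice) (I : Type).
Implicit Type F : I -> L.

Lemma fjoin_ub F i : F i ≤ fjoin F.
Proof. by apply: join_ub; exists i. Qed.

Lemma fjoin_least F u : (forall i, F i ≤ u) -> fjoin F ≤ u.
Proof. by move=> Fu; apply: join_least => _ [i ->]. Qed.

Lemma fmeet_lb F i : fmeet F ≤ F i.
Proof. by apply: join_least => l; apply; exists i. Qed.

Lemma fmeet_greatest F l : (forall i, l ≤ F i) -> l ≤ fmeet F.
Proof. by move=> lF; apply: join_ub => _ [i ->]. Qed.
End Lattice.

Section Quantaloid.
Variable Q : quantaloid.

Lemma compq_monor (X Y Z : Q) (g : hom Y Z) (f f' : hom X Y) :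
  f ≤ f' -> g ∘ f ≤ g ∘ f'.
Proof.
move=> ff'; have <- : join (fun h => h = f \/ h = f') = f'.
  apply: le_antisym; last by apply: join_ub; right.
  by apply: join_least => _ [->|->] //; apply: le_refl.
by rewrite compq_joinr; apply: join_ub; exists f => //; left.
Qed.

Lemma compq_monol (X Y Z : Q) (g g' : hom Y Z) (f : hom X Y) :
  g ≤ g' -> g ∘ f ≤ g' ∘ f.
Proof.
move=> gg'; have <- : join (fun h => h = g \/ h = g') = g'.
  apply: le_antisym; last by apply: join_ub; right.
  by apply: join_least => _ [->|->] //; apply: le_refl.
by rewrite compq_joinl; apply: join_ub; exists g => //; left.
Qed.

Lemma lda_comp (X Y Z : Q) (h : hom X Z) (f : hom X Y) : (h ↙ f) ∘ f ≤ h.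
Proof. by rewrite compq_joinl; apply: join_least => _ [g gh ->]. Qed.

Lemma rda_comp (X Y Z : Q) (g : hom Y Z) (h : hom X Z) : g ∘ (g ↘ h) ≤ h.
Proof. by rewrite compq_joinr; apply: join_least => _ [f fh ->]. Qed.

Lemma lda_largest (X Y Z : Q) (h : hom X Z) (f : hom X Y) (g : hom Y Z) :
  g ∘ f ≤ h -> g ≤ h ↙ f.
Proof. by move=> gfh; apply: join_ub. Qed.

Lemma rda_largest (X Y Z : Q) (g : hom Y Z) (h : hom X Z) (f : hom X Y) :
  g ∘ f ≤ h -> f ≤ g ↘ h.
Proof. by move=> gfh; apply: join_ub. Qed.

Lemma fjoin_compl (X Y Z : Q) I (F : I -> hom Y Z) (f : hom X Y) (u : hom X Z) :
  (forall i, F i ∘ f ≤ u) -> fjoin F ∘ f ≤ u.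
Proof.
by move=> Fu; rewrite compq_joinl; apply: join_least => _ [_ [i ->] ->].
Qed.

Lemma fjoin_compr (X Y Z : Q) I (g : hom Y Z) (F : I -> hom X Y) (u : hom X Z) :
  (forall i, g ∘ F i ≤ u) -> g ∘ fjoin F ≤ u.
Proof.
by move=> Fu; rewrite compq_joinr; apply: join_least => _ [_ [i ->] ->].
Qed.
End Quantaloid.

Record qcat (Q : quantaloid) := QCat {
  qob :> Type;
  ty : qob -> Q;
  qhom : forall x y : qob, hom (ty x) (ty y);
  qhom_id : forall x, idq (ty x) ≤ qhom x x;
  qhom_comp : forall x y z, qhom y z ∘ qhom x y ≤ qhom x z }.

(* Type preservation is a propositional equality of objects of Q, so arrows
   have to be transported along it before they can be compared. *)
Definition hom_cast (Q : quantaloid) (X X' Y Y' : Q) (eX : X = X') (eY : Y = Y')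
    (f : hom X Y) : hom X' Y' :=
  match eX in _ = U, eY in _ = V return hom U V with
  | eq_refl, eq_refl => f
  end.

Definition qle (Q : quantaloid) (A : qcat Q) (x y : A) : Prop :=
  exists e : ty x = ty y,
    idq (ty x) ≤ hom_cast (erefl (ty x)) (esym e) (qhom x y).

Record qfunctor (Q : quantaloid) (A B : qcat Q) := QFunctor {
  fobj :> A -> B;
  fobj_ty : forall x, ty (fobj x) = ty x;
  fobj_hom : forall x x',
    qhom x x' ≤ hom_cast (fobj_ty x) (fobj_ty x') (qhom (fobj x) (fobj x')) }.

Definition qfunctor_le (Q : quantaloid) (A B : qcat Q) (F G : qfunctor A B) :=
  forall x, qle (F x) (G x).

Definition qfunctor_id (Q : quantaloid) (A : qcat Q) : qfunctor A A :=
  @QFunctor Q A A id (fun x => erefl (ty x)) (fun x x' => le_refl (qhom x x')).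

Section FunctorComposition.
Variables (Q : quantaloid) (A B C : qcat Q).
Variables (G : qfunctor B C) (F : qfunctor A B).

Lemma qfunctor_comp_hom x x' :
  qhom x x' ≤ hom_cast (etrans (fobj_ty G (F x)) (fobj_ty F x))
                       (etrans (fobj_ty G (F x')) (fobj_ty F x'))
                       (qhom (G (F x)) (G (F x'))).
Proof.
apply: le_trans (fobj_hom F x x') _.
move: (fobj_hom G (F x) (F x')).
case: _ / (fobj_ty F x); case: _ / (fobj_ty F x') => /=.
by [].
Qed.

Definition qfunctor_comp : qfunctor A C :=
  @QFunctor Q A C (fun x => G (F x)) _ qfunctor_comp_hom.
End FunctorComposition.

Definition qadjoint (Q : quantaloid) (A B : qcat Q)
    (F : qfunctor A B) (G : qfunctor B A) : Prop :=
  qfunctor_le (qfunctor_id A) (qfunctor_comp G F) /\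
  qfunctor_le (qfunctor_comp F G) (qfunctor_id B).

Notation "F ⊣ G" := (qadjoint F G) (at level 70, no associativity)
  : quantaloid_scope.

Record dist (Q : quantaloid) (A B : qcat Q) := Dist {
  dfun :> forall (x : A) (y : B), hom (ty x) (ty y);
  dist_postcomp : forall x y' y, qhom y' y ∘ dfun x y' ≤ dfun x y;
  dist_precomp : forall x x' y, dfun x' y ∘ qhom x x' ≤ dfun x y }.

Section DistributorOperations.
Variables (Q : quantaloid) (A B C : qcat Q).

Section Composition.
Variables (psi : dist B C) (phi : dist A B).
Let F x z : hom (ty x) (ty z) := fjoin (fun y : B => psi y z ∘ phi x y).

Lemma dist_comp_post x z' z : qhom z' z ∘ F x z' ≤ F x z.
Proof.
apply: fjoin_compr => y; rewrite compqA.
apply: le_trans (fjoin_ub _ y).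
exact/compq_monol/dist_postcomp.
Qed.

Lemma dist_comp_pre x x' z : F x' z ∘ qhom x x' ≤ F x z.
Proof.
apply: fjoin_compl => y; rewrite -compqA.
apply: le_trans (fjoin_ub _ y).
exact/compq_monor/dist_precomp.
Qed.

Definition dist_comp : dist A C := Dist dist_comp_post dist_comp_pre.
End Composition.

Section LeftImplication.
Variables (eta : dist A C) (phi : dist A B).
Let F y z : hom (ty y) (ty z) := fmeet (fun x : A => eta x z ↙ phi x y).

Lemma dist_lda_post y z' z : qhom z' z ∘ F y z' ≤ F y z.
Proof.
apply: fmeet_greatest => x; apply: lda_largest; rewrite -compqA.
apply: le_trans (dist_postcomp eta x z' z); apply: compq_monor.
by apply: le_trans (lda_comp _ _); apply/compq_monol/(fmeet_lb _ x).
Qed.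

Lemma dist_lda_pre y y' z : F y' z ∘ qhom y y' ≤ F y z.
Proof.
apply: fmeet_greatest => x; apply: lda_largest; rewrite -compqA.
apply: le_trans (lda_comp (eta x z) (phi x y')).
apply: (@le_trans _ (F y' z ∘ phi x y')).
  exact/compq_monor/dist_postcomp.
exact/compq_monol/(fmeet_lb _ x).
Qed.

Definition dist_lda : dist B C := Dist dist_lda_post dist_lda_pre.
End LeftImplication.

Section RightImplication.
Variables (psi : dist B C) (eta : dist A C).
Let F x y : hom (ty x) (ty y) := fmeet (fun z : C => psi y z ↘ eta x z).

Lemma dist_rda_post x y' y : qhom y' y ∘ F x y' ≤ F x y.
Proof.
apply: fmeet_greatest => z; apply: rda_largest; rewrite compqA.
apply: le_trans (rda_comp (psi y' z) (eta x z)).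
apply: (@le_trans _ (psi y' z ∘ F x y')).
  exact/compq_monol/dist_precomp.
exact/compq_monor/(fmeet_lb _ z).
Qed.

Lemma dist_rda_pre x x' y : F x' y ∘ qhom x x' ≤ F x y.
Proof.
apply: fmeet_greatest => z; apply: rda_largest; rewrite compqA.
apply: le_trans (dist_precomp eta x x' z); apply: compq_monol.
by apply: le_trans (rda_comp (psi y z) _); apply/compq_monor/(fmeet_lb _ z).
Qed.

Definition dist_rda : dist A B := Dist dist_rda_post dist_rda_pre.
End RightImplication.
End DistributorOperations.

Section Star.
Variables (Q : quantaloid) (X : Q).

Lemma star_comp (_ _ _ : unit) : idq X ∘ idq X ≤ idq X.
Proof. by rewrite compq1; apply: le_refl. Qed.

Definition star : qcat Q :=
  @QCat Q unit (fun _ => X) (fun _ _ => idq X) (fun _ => le_refl (idq X))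
    star_comp.
End Star.

Record presheaf (Q : quantaloid) (A : qcat Q) := Presheaf {
  psh_ty : Q;
  psh_dist :> dist A (star psh_ty) }.

Record copresheaf (Q : quantaloid) (A : qcat Q) := Copresheaf {
  copsh_ty : Q;
  copsh_dist :> dist (star copsh_ty) A }.

Section PresheafCategories.
Variables (Q : quantaloid) (A : qcat Q).

(* A distributor between two one-object categories is identified with its
   only component, here the one at (tt, tt). *)
Let Phom (mu lam : presheaf A) : hom (psh_ty mu) (psh_ty lam) :=
  dist_lda lam mu tt tt.

Lemma Phom_id mu : idq (psh_ty mu) ≤ Phom mu mu.
Proof.
apply: fmeet_greatest => x; apply: lda_largest.
by rewrite comp1q; apply: le_refl.
Qed.

Lemma Phom_comp mu lam nu : Phom lam nu ∘ Phom mu lam ≤ Phom mu nu.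
Proof.
apply: fmeet_greatest => x; apply: lda_largest; rewrite -compqA.
apply: le_trans (lda_comp (nu x tt) (lam x tt)).
apply: (@le_trans _ (Phom lam nu ∘ lam x tt)).
  apply: compq_monor; apply: le_trans (lda_comp (lam x tt) (mu x tt)).
  exact/compq_monol/(fmeet_lb _ x).
exact/compq_monol/(fmeet_lb _ x).
Qed.

Definition Pcat : qcat Q :=
  @QCat Q (presheaf A) (@psh_ty Q A) Phom Phom_id Phom_comp.

Let Pdhom (mu lam : copresheaf A) : hom (copsh_ty mu) (copsh_ty lam) :=
  dist_rda lam mu tt tt.

Lemma Pdhom_id mu : idq (copsh_ty mu) ≤ Pdhom mu mu.
Proof.
apply: fmeet_greatest => x; apply: rda_largest.
by rewrite compq1; apply: le_refl.
Qed.

Lemma Pdhom_comp mu lam nu : Pdhom lam nu ∘ Pdhom mu lam ≤ Pdhom mu nu.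
Proof.
apply: fmeet_greatest => x; apply: rda_largest; rewrite compqA.
apply: le_trans (rda_comp (lam tt x) (mu tt x)).
apply: (@le_trans _ (lam tt x ∘ Pdhom mu lam)).
  apply: compq_monol; apply: le_trans (rda_comp (nu tt x) (lam tt x)).
  exact/compq_monor/(fmeet_lb _ x).
exact/compq_monor/(fmeet_lb _ x).
Qed.

Definition Pdcat : qcat Q :=
  @QCat Q (copresheaf A) (@copsh_ty Q A) Pdhom Pdhom_id Pdhom_comp.
End PresheafCategories.

Section InducedFunctors.
Variables (Q : quantaloid) (A B : qcat Q) (phi : dist A B).

Let ustar (lam : Pcat B) : Pcat A := Presheaf (dist_comp lam phi).
Let lstar (mu : Pcat A) : Pcat B := Presheaf (dist_lda mu phi).
Let udag (mu : Pdcat A) : Pdcat B := Copresheaf (dist_comp phi mu).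
Let ldag (lam : Pdcat B) : Pdcat A := Copresheaf (dist_rda phi lam).

Lemma ustar_hom (l l' : Pcat B) : qhom l l' ≤ qhom (ustar l) (ustar l').
Proof.
apply: fmeet_greatest => x; apply: lda_largest.
apply: fjoin_compr => y; rewrite compqA.
apply: le_trans (fjoin_ub _ y); apply: compq_monol.
apply: le_trans (lda_comp _ (l y tt)); exact/compq_monol/(fmeet_lb _ y).
Qed.

Lemma lstar_hom (m m' : Pcat A) : qhom m m' ≤ qhom (lstar m) (lstar m').
Proof.
apply: fmeet_greatest => y; apply: lda_largest.
apply: fmeet_greatest => x; apply: lda_largest; rewrite -compqA.
apply: (@le_trans _ (qhom m m' ∘ m x tt)).
  apply: compq_monor; apply: le_trans (lda_comp _ (phi x y)).
  exact/compq_monol/(fmeet_lb _ x).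
apply: le_trans (lda_comp _ (m x tt)); exact/compq_monol/(fmeet_lb _ x).
Qed.

Lemma udag_hom (m m' : Pdcat A) : qhom m m' ≤ qhom (udag m) (udag m').
Proof.
apply: fmeet_greatest => y; apply: rda_largest.
apply: fjoin_compl => x; rewrite -compqA.
apply: le_trans (fjoin_ub _ x); apply: compq_monor.
apply: le_trans (rda_comp (m' tt x) _); exact/compq_monor/(fmeet_lb _ x).
Qed.

Lemma ldag_hom (l l' : Pdcat B) : qhom l l' ≤ qhom (ldag l) (ldag l').
Proof.
apply: fmeet_greatest => x; apply: rda_largest.
apply: fmeet_greatest => y; apply: rda_largest; rewrite compqA.
apply: (@le_trans _ (l' tt y ∘ qhom l l')).
  apply: compq_monol; apply: le_trans (rda_comp (phi x y) _).
  exact/compq_monor/(fmeet_lb _ y).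
apply: le_trans (rda_comp (l' tt y) _); exact/compq_monor/(fmeet_lb _ y).
Qed.

Definition upper_star : qfunctor (Pcat B) (Pcat A) :=
  @QFunctor Q (Pcat B) (Pcat A) ustar (fun l => erefl (psh_ty l)) ustar_hom.

Definition lower_star : qfunctor (Pcat A) (Pcat B) :=
  @QFunctor Q (Pcat A) (Pcat B) lstar (fun m => erefl (psh_ty m)) lstar_hom.

Definition upper_dagger : qfunctor (Pdcat A) (Pdcat B) :=
  @QFunctor Q (Pdcat A) (Pdcat B) udag (fun m => erefl (copsh_ty m)) udag_hom.

Definition lower_dagger : qfunctor (Pdcat B) (Pdcat A) :=
  @QFunctor Q (Pdcat B) (Pdcat A) ldag (fun l => erefl (copsh_ty l)) ldag_hom.
End InducedFunctors.

(* Main.v *)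
From mathcomp Require Import ssreflect ssrfun ssrbool.
Require Import Defs.
Local Open Scope quantaloid_scope.

(** Both adjunctions are residuation in the quantaloid of distributors: [- ∘ phi] is left adjoint to
    [- ↙ phi], and [phi ∘ -] to [phi ↘ -], for the pointwise order. [qle_Pcat] and [qle_Pdcat]
    reduce the underlying orders to that order, reversed for copresheaves; the reversal is why
    [phi ↘ -] ends up as the left adjoint. *)

Lemma qle_Pcat (Q : quantaloid) (A : qcat Q) (X : Q) (mu lam : dist A (star X)) :
  (forall x, mu x tt ≤ lam x tt) ->
  @qle Q (Pcat A) (Presheaf mu) (Presheaf lam).
Proof.
move=> le_ml; exists erefl; apply: fmeet_greatest => x.
by apply: lda_largest; rewrite comp1q; apply: le_ml.
Qed.

(** The order flips because the hom from [mu] to [lam] is [lam ↘ mu], which lies above the identity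
    as soon as [lam ≤ mu]. The shared type [X] makes the cast trivial. *)
Lemma qle_Pdcat (Q : quantaloid) (A : qcat Q) (X : Q) (mu lam : dist (star X) A) :
  (forall x, lam tt x ≤ mu tt x) ->
  @qle Q (Pdcat A) (Copresheaf mu) (Copresheaf lam).
Proof.
move=> le_lm; exists erefl; apply: fmeet_greatest => x.
by apply: rda_largest; rewrite compq1; apply: le_lm.
Qed.

Section DistributorImplications.
Variables (Q : quantaloid) (A B C : qcat Q).

Lemma dist_le_lda_comp (psi : dist B C) (phi : dist A B) y z :
  psi y z ≤ dist_lda (dist_comp psi phi) phi y z.
Proof.
apply: fmeet_greatest => x; apply: lda_largest.
exact: (fjoin_ub (fun y' => psi y' z ∘ phi x y')).
Qed.

Lemma dist_lda_comp_le (eta : dist A C) (phi : dist A B) x z :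
  dist_comp (dist_lda eta phi) phi x z ≤ eta x z.
Proof.
apply: fjoin_least => y; apply: le_trans (lda_comp _ (phi x y)).
exact/compq_monol/(fmeet_lb _ x).
Qed.

Lemma dist_le_rda_comp (psi : dist B C) (phi : dist A B) x y :
  phi x y ≤ dist_rda psi (dist_comp psi phi) x y.
Proof.
apply: fmeet_greatest => z; apply: rda_largest.
exact: (fjoin_ub (fun y' => psi y' z ∘ phi x y')).
Qed.

Lemma dist_rda_comp_le (psi : dist B C) (eta : dist A C) x z :
  dist_comp psi (dist_rda psi eta) x z ≤ eta x z.
Proof.
apply: fjoin_least => y; apply: le_trans (rda_comp (psi y z) _).
exact/compq_monor/(fmeet_lb _ z).
Qed.
End DistributorImplications.

Theorem proposition6p2p1 (Q : quantaloid) (A B : qcat Q) (phi : dist A B) :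
  upper_star phi ⊣ lower_star phi /\ lower_dagger phi ⊣ upper_dagger phi.
Proof.
(* Exposing the type [X] lets both sides of each inequality be presheaves, or copresheaves, of
   literally the same type. *)
split; split=> -[X mu].
- by apply: qle_Pcat => y; apply: dist_le_lda_comp.
- by apply: qle_Pcat => x; apply: dist_lda_comp_le.
(* By the order reversal, the unit here is the counit of residuation, and vice versa in the next
   case. *)
- by apply: qle_Pdcat => y; apply: dist_rda_comp_le.
- by apply: qle_Pdcat => x; apply: dist_le_rda_comp.
Qed.
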